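(* Let $S\subseteq\mathbb{N}^d$ be a simplicial affine semigroup with extremal rays $\mathbf{a}_1,\dots,\mathbf{a}_d$, let $r(\operatorname{Ap}(S,E))=\{0=\mathbf{b}_0,\mathbf{b}_1,\dots,\mathbf{b}_k\}$ (distinct elements), and let $C_j=\{\mathbf{w}\in\operatorname{Ap}(S,E) : r(\mathbf{w})=\mathbf{b}_j\}$ for $j=0,\dots,k$. Let $\mathbf{c}$ be a minimal generator of the conductor $\mathfrak{c}(S)$ as an ideal of $\bar S$. Then there exist $(\mathbf{w}_1,\dots,\mathbf{w}_k)\in C_1\times\dots\times C_k$, $l_1,\dots,l_d\in\{0,1\}$ and $j\in\{0,\dots,k\}$ such that $$\mathbf{c}=\mathbf{f}_{(\mathbf{w}_1,\dots,\mathbf{w}_k)}-\mathbf{b}_j+\sum_{i=1}^d l_i\mathbf{a}_i .$$ Moreover, $l_i=0$ for at least one $i$.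
   Context: $\mathbb{N}$ denotes the nonnegative integers and $d\ge 1$. An affine semigroup is a finitely generated submonoid $S$ of $\mathbb{N}^d$; it has a unique minimal generating set $\operatorname{mgs}(S)$. $S$ is simplicial if there are $d$ elements of $\operatorname{mgs}(S)$, linearly independent over $\mathbb{Q}$, such that every $\mathbf{a}\in S$ has a positive multiple $n\mathbf{a}$ that is an $\mathbb{N}$-linear combination of these $d$ elements. Equivalently, $\operatorname{cone}(S)$, the set of nonnegative real combinations of elements of $S$, has exactly $d$ one-dimensional extremal rays. The smallest nonzero element of $S$ on each of these rays is called an extremal ray of $S$; these are $\mathbf{a}_1,\dots,\mathbf{a}_d$, they form a basis of $\mathbb{R}^d$ and span $\operatorname{cone}(S)$, and $E=\{\mathbf{a}_1,\dots,\mathbf{a}_d\}$. For $\mathbf{z}=\sum_{i=1}^d\lambda_i\mathbf{a}_i$ write $[\mathbf{z}]_i=\lambda_i$. $P_S=\{\sum_{i=1}^d\lambda_i\mathbf{a}_i : 0\le\lambda_i<1\text{ for all } i\}$. Every $\mathbf{a}\in\operatorname{cone}(S)\cap\mathbb{N}^d$ is uniquely $\mathbf{a}=\sum_{i=1}^d n_i\mathbf{a}_i+r(\mathbf{a})$ with $n_i\in\mathbb{N}$ and $r(\mathbf{a})\in P_S\cap\mathbb{N}^d$; $r(\mathbf{a})$ is the remainder of $\mathbf{a}$. $\operatorname{Ap}(S,E)=\{\mathbf{a}\in S : \mathbf{a}-\mathbf{a}_i\notin S\text{ for all } i\}$, a finite set, and $r(\operatorname{Ap}(S,E))=\{r(\mathbf{w})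 : \mathbf{w}\in\operatorname{Ap}(S,E)\}$. For $(\mathbf{w}_1,\dots,\mathbf{w}_k)\in C_1\times\dots\times C_k$, $\mathbf{f}_{(\mathbf{w}_1,\dots,\mathbf{w}_k)}=\sum_{i=1}^d f_i\mathbf{a}_i$, where $f_i=\max\{[\mathbf{w}_j-r(\mathbf{w}_j)]_i : j=1,\dots,k\}=\max\{\lfloor[\mathbf{w}_j]_i\rfloor : j=1,\dots,k\}$ (and $f_i=0$ if $k=0$). $\operatorname{group}(S)=\{\mathbf{a}-\mathbf{b} : \mathbf{a},\mathbf{b}\in S\}$; the normalization of $S$ is $\bar S=\operatorname{group}(S)\cap\operatorname{cone}(S)$; the conductor of $S$ is $\mathfrak{c}(S)=\{\mathbf{b}\in S : \mathbf{b}+\bar S\subseteq S\}$, which is an ideal of $\bar S$ (i.e. $\mathfrak{c}(S)+\bar S\subseteq\mathfrak{c}(S)$). A set $B$ generates an ideal $H$ of $\bar S$ if $H=B+\bar S$; every ideal has a unique minimal generating set, and its elements are the minimal generators. *)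

(* Defs.v *)
From HB Require Import structures.
From mathcomp Require Import all_boot all_order all_algebra.
From mathcomp Require Import boolp classical_sets functions cardinality reals.

Set Implicit Arguments.
Unset Strict Implicit.
Unset Printing Implicit Defensive.

Import Order.TTheory GRing.Theory Num.Theory.
Local Open Scope classical_set_scope.
Local Open Scope ring_scope.

(* All objects live in R^d, seen as row vectors: N^d is the set of vectors
   with natural coordinates, and an affine semigroup is a subset of it. *)

Section SimplicialAffineSemigroups.
Variables (R : realType) (d : nat).
Local Notation V := 'rV[R]_d.

Definition natvec : set V := [set v | forall j, exists n : nat, v ord0 j = n%:R].

Definition monoid_gen (G : set V) : set V :=
  [set x | exists2 s : seq V, (forall g, g \in s -> G g) & x = \sum_(g <- s) g].

Definition affine_semigroup (S : set V) : Prop :=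
  S `<=` natvec /\ exists2 G : set V, finite_set G & S = monoid_gen G.

Definition is_mgs (S M : set V) : Prop :=
  S = monoid_gen M /\
  forall M' : set V, M' `<=` M -> S = monoid_gen M' -> M' = M.

Definition Qfree (e : 'I_d -> V) : Prop :=
  forall q : 'I_d -> rat, \sum_i ratr (q i) *: e i = 0 -> forall i, q i = 0.

Definition simplicial (S : set V) : Prop :=
  exists2 M : set V, is_mgs S M &
  exists e : 'I_d -> V,
    [/\ forall i, M (e i),
        Qfree e &
        forall x, S x -> exists2 n : nat, (0 < n)%N &
          exists m : 'I_d -> nat, x *+ n = \sum_i e i *+ m i].

Definition cone (S : set V) : set V :=
  [set x | exists (n : nat) (s : 'I_n -> V) (l : 'I_n -> R),
     [/\ forall i, S (s i), forall i, 0 <= l i & x = \sum_i l i *: s i]].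

Definition ray (v : V) : set V :=
  [set x | exists2 t : R, 0 <= t & x = t *: v].

(* [ray v] is a one-dimensional face of the convex cone [K] *)
Definition extremal_direction (K : set V) (v : V) : Prop :=
  [/\ K v, v <> 0 &
      forall x y, K x -> K y -> ray v (x + y) -> ray v x /\ ray v y].

(* "Smallest" refers to the coordinatewise order, which is total on a ray of
   the nonnegative orthant. *)
Definition extremal_rays (S : set V) : set V :=
  [set v | [/\ S v, extremal_direction (cone S) v &
     forall x, S x -> x <> 0 -> ray v x -> forall j, v ord0 j <= x ord0 j]].

Definition acoord (a : 'I_d -> V) (z : V) (i : 'I_d) : R :=
  coord [tuple a i | i < d] i z.

Definition parallelotope (a : 'I_d -> V) : set V :=
  [set z | exists2 l : 'I_d -> R,
     (forall i, 0 <= l i < 1) & z = \sum_i l i *: a i].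

Definition is_remainder (a : 'I_d -> V) (x r : V) : Prop :=
  [/\ parallelotope a r, natvec r &
      exists n : 'I_d -> nat, x = \sum_i a i *+ n i + r].

(* Such a vector exists and is unique for [x] in [cone S `&` natvec]; the
   default value [0] is irrelevant there. *)
Definition remainder (a : 'I_d -> V) (x : V) : V :=
  xget 0 [set r | is_remainder a x r].

Definition Apery (S E : set V) : set V :=
  [set x | S x /\ forall e, E e -> ~ S (x - e)].

(* The coordinates of [w j - remainder a (w j)] are natural numbers when the
   [w j] lie in [S], so starting the maximum at 0 only matters when k = 0. *)
Definition fvec (a : 'I_d -> V) (k : nat) (w : 'I_k -> V) : V :=
  \sum_i (\big[Num.max/0]_(j < k) acoord a (w j - remainder a (w j)) i) *: a i.

Definition group_of (S : set V) : set V :=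
  [set x | exists y z, [/\ S y, S z & x = y - z]].

Definition normalization (S : set V) : set V := group_of S `&` cone S.

Definition conductor (S : set V) : set V :=
  [set x | S x /\ forall y, normalization S y -> S (x + y)].

Definition ideal_gen (T B : set V) : set V :=
  [set x | exists y z, [/\ B y, T z & x = y + z]].

Definition is_min_ideal_gen_set (T H B : set V) : Prop :=
  H = ideal_gen T B /\
  forall B' : set V, B' `<=` B -> H = ideal_gen T B' -> B' = B.

Definition minimal_generator (T H : set V) (c : V) : Prop :=
  exists2 B : set V, is_min_ideal_gen_set T H B & B c.

End SimplicialAffineSemigroups.

(* Main.v *)
Require Import Defs.
From HB Require Import structures.
From mathcomp Require Import all_boot all_order all_algebra.
From mathcomp Require Import boolp classical_sets functions cardinality reals.
From mathcomp Require Import zify lra.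

Set Implicit Arguments.
Unset Strict Implicit.
Unset Printing Implicit Defensive.

Import Order.TTheory GRing.Theory Num.Theory.
Local Open Scope classical_set_scope.
Local Open Scope ring_scope.

(** Let [λ] denote coordinates with respect to the extremal rays [a i], and let
    [L] be their integer span. Every class of [group S] modulo [L] contains
    exactly one [b j], and an element of [group S] lies in [S] iff it dominates,
    coordinatewise, an Apery element of its class. So for [c] in the conductor
    each class contains an Apery element [w j] dominated by the unique
    [c + b p] of that class. Let [c + b j0] be the one lying in [L]; since the
    [b p] have coordinates in [0, 1), the floors of the [w j] are at most
    [λ (c + b j0)], so [l := λ (c + b j0) - f] is a vector of natural numbers.
    If [l i >= 2], then [c - a i] is still in the conductor; if [l i >= 1] for
    all [i], then so is [c + b j0 - \sum_i a i]. Either contradicts the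
    minimality of [c]. *)

(** * Coordinates with respect to a basis and the lattice it spans *)

Section Basis.
Variables (R : realType) (d : nat) (a : 'I_d -> 'rV[R]_d).
Local Notation V := 'rV[R]_d.

(** For a basis [a] this is the integer span of the [a i]; going through coordinates, the closure
    properties come before any freeness assumption. *)
Definition lattice : set V := [set x | forall i, acoord a x i \is a Num.int].

Lemma acoord0 i : acoord a 0 i = 0.
Proof. by rewrite /acoord linear0. Qed.

Lemma acoordD x y i : acoord a (x + y) i = acoord a x i + acoord a y i.
Proof. by rewrite /acoord linearD. Qed.

Lemma acoordN x i : acoord a (- x) i = - acoord a x i.
Proof. by rewrite /acoord linearN. Qed.

Lemma acoordB x y i : acoord a (x - y) i = acoord a x i - acoord a y i.
Proof. by rewrite /acoord linearB. Qed.

Lemma acoordZ t x i : acoord a (t *: x) i = t * acoord a x i.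
Proof. by rewrite /acoord linearZ. Qed.

Lemma acoordMn x n i : acoord a (x *+ n) i = acoord a x i *+ n.
Proof. by rewrite /acoord raddfMn. Qed.

Lemma acoord_bigsum n (F : 'I_n -> V) i :
  acoord a (\sum_j F j) i = \sum_j acoord a (F j) i.
Proof. by rewrite /acoord linear_sum. Qed.

Lemma lattice0 : lattice 0.
Proof. by move=> i; rewrite acoord0. Qed.

Lemma latticeD x y : lattice x -> lattice y -> lattice (x + y).
Proof. by move=> hx hy i; rewrite acoordD rpredD. Qed.

Lemma latticeB x y : lattice x -> lattice y -> lattice (x - y).
Proof. by move=> hx hy i; rewrite acoordB rpredB. Qed.

Lemma lattice_subC x y : lattice (x - y) -> lattice (y - x).
Proof.
by move=> h; rewrite -opprB -sub0r; apply: latticeB h; apply: lattice0.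
Qed.

Lemma lattice_sub_trans y x z :
  lattice (x - y) -> lattice (y - z) -> lattice (x - z).
Proof.
by move=> hx hz; rewrite -(subrKA y); exact: latticeD.
Qed.

Hypothesis a_free : free [tuple a i | i < d].

Lemma acoord_sum (l : 'I_d -> R) i : acoord a (\sum_j l j *: a j) i = l i.
Proof.
rewrite /acoord -[RHS](coord_sum_free l i a_free); congr coord.
by apply: eq_bigr => j _; rewrite -tnth_nth tnth_mktuple.
Qed.

Lemma acoord_sumMn (n : 'I_d -> nat) i :
  acoord a (\sum_j a j *+ n j) i = (n i)%:R.
Proof.
rewrite -(acoord_sum (fun j => (n j)%:R)); congr (acoord a _ i).
by apply: eq_bigr => j _; rewrite scaler_nat.
Qed.

Lemma acoord_basis j i : acoord a (a j) i = (i == j)%:R.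
Proof.
rewrite -(acoord_sum (fun i => (i == j)%:R)); congr (acoord a _ i).
by rewrite (bigD1 j) //= eqxx scale1r big1 ?addr0// => k /negPf ->; rewrite scale0r.
Qed.

(** A free family of [d] vectors spans a space of dimension [d]. *)
Lemma acoordE x : x = \sum_i acoord a x i *: a i.
Proof.
have xX : x \in <<[tuple a i | i < d]>>%VS.
  suff -> : (<<[tuple a i | i < d]>> = fullv)%VS by rewrite memvf.
  apply/eqP; rewrite eqEdim subvf (eqP (a_free : _ == _)) size_tuple.
  by rewrite dimvf /dim /= mul1n.
rewrite {1}(coord_span xX); apply: eq_bigr => i _.
by rewrite -tnth_nth tnth_mktuple.
Qed.

Lemma acoord_inj x y : acoord a x =1 acoord a y -> x = y.
Proof.
by move=> h; rewrite (acoordE x) (acoordE y); apply: eq_bigr => i _; rewrite h.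
Qed.

Lemma parallelotopeP x :
  parallelotope a x <-> forall i, 0 <= acoord a x i < 1.
Proof.
split=> [[l l01 ->] i|h]; first by rewrite acoord_sum.
by exists (acoord a x) => //; exact: acoordE.
Qed.

Lemma lattice_basis i : lattice (a i).
Proof. by move=> j; rewrite acoord_basis. Qed.

Lemma lattice_sumMn (n : 'I_d -> nat) : lattice (\sum_i a i *+ n i).
Proof. by move=> i; rewrite acoord_sumMn. Qed.

(** Each coordinate of the difference is an integer strictly between -1 and 1, hence 0. This yields
    the uniqueness of remainders. *)
Lemma lattice_sub_cell x y :
  (forall i, 0 <= acoord a x i < 1) -> (forall i, 0 <= acoord a y i < 1) ->
  lattice (x - y) -> x = y.
Proof.
move=> hx hy hxy; apply: acoord_inj => i; apply/eqP; rewrite -subr_eq0.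
have := hxy i; have := hx i; have := hy i; rewrite acoordB.
move: (acoord _ x i) (acoord _ y i) => u v v01 u01 /intrP[m e]; rewrite e.
have : (-1)%:~R < m%:~R :> R by rewrite -e; lra.
have : m%:~R < 1%:~R :> R by rewrite -e; lra.
rewrite !ltr_int intr_eq0; lia.
Qed.

End Basis.

(** * Transfer of linear algebra between the rationals and the reals *)

Section Rationality.
Variables (R : realType) (d : nat).
Local Notation V := 'rV[R]_d.

(** Meant for rows in [natvec], where the floor loses nothing and [ratr] maps this matrix back to
    the real one. *)
Definition ratmx (e : 'I_d -> V) : 'M[rat]_d :=
  \matrix_(i, j) (Num.floor (e i 0 j))%:~R.

Lemma natvec_floor (x : V) j : natvec x -> (Num.floor (x 0 j))%:~R = x 0 j.
Proof. by move=> /(_ j)[n ->]; rewrite floorK ?rpred_nat. Qed.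

Lemma map_ratmx (e : 'I_d -> V) : (forall i, natvec (e i)) ->
  map_mx ratr (ratmx e) = \matrix_i e i.
Proof.
by move=> he; apply/matrixP=> i j; rewrite !mxE ratr_int natvec_floor.
Qed.

Lemma free_row_free (e : 'I_d -> V) :
  free [tuple e i | i < d] <-> row_free (\matrix_i e i).
Proof.
have sumE (l : 'I_d -> R) :
    \sum_(i < d) l i *: [tuple e i | i < d]`_i = (\row_i l i) *m \matrix_i e i.
  rewrite mulmx_sum_row; apply: eq_bigr => i _.
  by rewrite mxE rowK -tnth_nth tnth_mktuple.
split=> [/freeP h|h].
  apply: inj_row_free => v hv; apply/rowP => i; rewrite mxE.
  apply: (h (fun i => v 0 i)); rewrite sumE -[RHS]hv; congr (_ *m _).
  by apply/rowP => j; rewrite mxE.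
apply/freeP => l; rewrite sumE => hl i.
have /rowP/(_ i) : \row_i l i = 0 by apply: (row_free_inj h); rewrite hl mul0mx.
by rewrite !mxE.
Qed.

(** The rank of a rational matrix does not change under extension to the reals. *)
Lemma Qfree_free (e : 'I_d -> V) : (forall i, natvec (e i)) -> Qfree e ->
  free [tuple e i | i < d].
Proof.
move=> he qfree; apply/free_row_free; rewrite -map_ratmx// row_free_map.
apply: inj_row_free => v hv; apply/rowP => i; rewrite mxE.
apply: (qfree (fun i => v 0 i)).
have /(congr1 (map_mx (@ratr R))) := hv; rewrite map_mxM map_ratmx// map_mx0.
rewrite mulmx_sum_row => /(etrans _); apply; apply: eq_bigr => j _.
by rewrite rowK mxE.
Qed.

(** The coordinates of [x] solve a linear system with integer data, so they are rational, and a
    common denominator serves as [n]. *)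
Lemma natvec_multiple_lattice (a : 'I_d -> V) (x : V) :
  free [tuple a i | i < d] -> (forall i, natvec (a i)) -> natvec x ->
  exists2 n : nat, (0 < n)%N & lattice a (x *+ n).
Proof.
move=> a_free a_nat x_nat.
(* [y] is the rational solution of [y *m ratmx a = x]. *)
pose y : 'rV[rat]_d := (\row_j (Num.floor (x 0 j))%:~R) *m invmx (ratmx a).
have yE i : acoord a x i = ratr (y 0 i).
  rewrite -(acoord_sum a_free (fun i => ratr (y 0 i))); congr (acoord a _ i).
  have aU : ratmx a \in unitmx.
    by rewrite -row_free_unit -(row_free_map (@ratr R)) map_ratmx//;
      apply/free_row_free.
  have : map_mx (@ratr R) (y *m ratmx a) = x.
    by rewrite mulmxKV//; apply/rowP => j; rewrite !mxE ratr_int natvec_floor.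
  rewrite map_mxM map_ratmx// mulmx_sum_row => {1}<-.
  by apply: eq_bigr => j _; rewrite rowK mxE.
exists (\prod_i `|denq (y 0%R i)|)%N.
  by apply: prodn_gt0 => i; rewrite absz_gt0 denq_neq0.
move=> i; rewrite acoordMn yE (bigD1 i)//= mulrnA rpredMn//.
rewrite -mulr_natr -ratr_nat -rmorphM /=.
rewrite natr_absz gtr0_norm ?denq_gt0// -{1}[y 0 i]divq_num_den.
by rewrite divfK ?intr_eq0 ?denq_neq0// ratr_int.
Qed.

End Rationality.

(** * Generated monoids and extremal directions *)

Section MonoidGen.
Variables (R : realType) (d : nat).
Local Notation V := 'rV[R]_d.

Lemma monoid_gen0 (G : set V) : monoid_gen G 0.
Proof. by exists [::]; rewrite ?big_nil. Qed.

Lemma monoid_genD (G : set V) x y :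
  monoid_gen G x -> monoid_gen G y -> monoid_gen G (x + y).
Proof.
move=> [s sG ->] [t tG ->]; exists (s ++ t); last by rewrite big_cat.
by move=> g; rewrite mem_cat => /orP[/sG|/tG].
Qed.

Lemma sub_monoid_gen (G : set V) : G `<=` monoid_gen G.
Proof.
move=> x Gx; exists [:: x]; last by rewrite big_seq1.
by move=> g; rewrite inE => /eqP ->.
Qed.

(** Each of the two vectors lies on the ray of the other, so each is coordinatewise at most the
    other by minimality. *)
Lemma ray_comparable_eq (S : set V) x y t :
  extremal_rays S x -> extremal_rays S y -> 0 < t -> y = t *: x -> x = y.
Proof.
move=> [Sx [_ x0 _] xmin] [Sy [_ y0 _] ymin] t0 yE; apply/rowP => j.
apply/eqP; rewrite eq_le; apply/andP; split.
  by apply: xmin => //; exists t => //; exact: ltW.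
apply: ymin => //; exists t^-1; first by rewrite invr_ge0 ltW.
by rewrite yE scalerA mulVf ?scale1r// gt_eqF.
Qed.

(* Splitting an extremal vector along the simplicial basis [e] leaves a single
   nonzero term. *)
Lemma extremal_direction_simplicial (S : set V) (e : 'I_d -> V) v :
  (forall i, S (e i)) -> (forall i, e i <> 0) ->
  (forall x, S x -> exists2 n : nat, (0 < n)%N &
     exists m : 'I_d -> nat, x *+ n = \sum_i e i *+ m i) ->
  extremal_direction (cone S) v ->
  exists i (t : R), 0 < t /\ e i = t *: v.
Proof.
move=> eS e0 Se [[n [s [l [sS l0 vE]]]] v0 vext].
have /choice[f hf] i :
    exists f : 'I_d -> R, (forall j, 0 <= f j) /\ s i = \sum_j f j *: e j.
  have [p p0 [m hm]] := Se _ (sS i).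
  exists (fun j => (m j)%:R / p%:R); split=> [j|]; first by rewrite divr_ge0.
  have pR : p%:R != 0 :> R by rewrite pnatr_eq0 -lt0n.
  apply: (scalerI pR); rewrite scaler_nat hm scaler_sumr; apply: eq_bigr => j _.
  by rewrite scalerA mulrCA divff// mulr1 scaler_nat.
pose mu j := \sum_i l i * f i j.
have mu0 j : 0 <= mu j by apply: sumr_ge0 => i _; rewrite mulr_ge0// (hf i).1.
have vmu : v = \sum_j mu j *: e j.
  rewrite vE; under eq_bigr => i _ do rewrite (hf i).2 scaler_sumr.
  rewrite exchange_big; apply: eq_bigr => j _.
  by rewrite scaler_suml; apply: eq_bigr => i _; rewrite scalerA.
have [j muj] : exists j, mu j != 0.
  apply: contrapT => h; apply: v0; rewrite vmu big1// => j _.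
  have [->|mj] := eqVneq (mu j) 0; first by rewrite scale0r.
  by case: h; exists j.
have coneE (P : pred 'I_d) : cone S (\sum_(j | P j) mu j *: e j).
  exists d, e, (fun j => if P j then mu j else 0); split=> // [i|].
    by case: ifP.
  rewrite [LHS]big_mkcond; apply: eq_bigr => i _.
  by case: ifP; rewrite ?scale0r.
have [] := vext (\sum_(i | i == j) mu i *: e i) (\sum_(i | i != j) mu i *: e i).
- exact: coneE.
- exact: coneE.
- exists 1; first exact: ler01.
  by rewrite scale1r [RHS]vmu [RHS](bigID (fun i => i == j)).
rewrite big_pred1_eq => -[t t0 ht] _.
have ejE : e j = ((mu j)^-1 * t) *: v by rewrite -scalerA -ht scalerA mulVf// scale1r.
exists j, ((mu j)^-1 * t); split=> //.
rewrite lt_neqAle mulr_ge0 ?invr_ge0// andbT eq_sym; apply/eqP => h.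
by apply: (e0 j); rewrite ejE h scale0r.
Qed.

End MonoidGen.

(** * The extremal rays form a basis in which [S] has nonnegative coordinates *)

Section ExtremalBasis.
Variables (R : realType) (d : nat) (S : set 'rV[R]_d) (a : 'I_d -> 'rV[R]_d).
Hypotheses (S_affine : affine_semigroup S) (S_simplicial : simplicial S).
Hypotheses (a_inj : injective a) (a_extremal : range a = extremal_rays S).

(** Up to a permutation [sg] and positive scalars [t], the family [a] is the simplicial family [e],
    so freeness and nonnegativity pass from [e] to [a]. *)
Lemma extremal_rays_basis :
  free [tuple a i | i < d] /\ forall x i, S x -> 0 <= acoord a x i.
Proof.
have [M [SM _] [e [eM eQ Se]]] := S_simplicial.
have [Snat _] := S_affine.
have eS i : S (e i) by rewrite SM; apply: sub_monoid_gen.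
have e_free : free [tuple e i | i < d].
  by apply: Qfree_free eQ => i; exact/Snat.
have e0 i : e i <> 0.
  move=> h; have := acoord_basis e_free i i.
  by rewrite h acoord0 eqxx => /eqP; rewrite eq_sym oner_eq0.
have aext i : extremal_rays S (a i) by rewrite -a_extremal; exists i.
have /choice[sg] i : exists j, exists t : R, 0 < t /\ e j = t *: a i.
  by case: (aext i) => _ ad _; exact: extremal_direction_simplicial ad.
move=> /choice[t ht].
(* Extremal rays matched with the same [e j] are positive multiples of each other, hence equal. An
   injection of ['I_d] into itself is then a bijection, with inverse [invF sg_inj]. *)
have sg_inj : injective sg.
  move=> i i' sgE; apply: a_inj.
  have [ti eE] := ht i; have [ti' eE'] := ht i'.
  apply: (@ray_comparable_eq _ _ S _ _ ((t i')^-1 * t i)) => //.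
    by rewrite mulr_gt0// invr_gt0.
  by rewrite -scalerA -eE sgE eE' scalerA mulVf ?scale1r// gt_eqF.
have a_free : free [tuple a i | i < d].
  apply/freeP => l hl i.
  (* The given relation among the [a i], rewritten in terms of [e]. *)
  have : \sum_j (l (invF sg_inj j) / t (invF sg_inj j)) *: e j = 0.
    rewrite -[RHS]hl (reindex_inj sg_inj); apply: eq_bigr => j _.
    rewrite invF_f (ht j).2 scalerA divfK ?gt_eqF ?(ht j).1//.
    by rewrite -tnth_nth tnth_mktuple.
  move=> /(congr1 (fun x => acoord e x (sg i))).
  rewrite acoord_sum// acoord0 invF_f => /eqP.
  by rewrite mulf_eq0 invr_eq0 (gt_eqF (ht i).1) orbF => /eqP.
split=> // x i Sx.
have [n n0 [m hm]] := Se x Sx.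
suff : 0 <= acoord a (x *+ n) i by rewrite acoordMn pmulrn_lge0.
rewrite hm (reindex_inj sg_inj) acoord_bigsum sumr_ge0// => j _.
rewrite (ht j).2 acoordMn acoordZ acoord_basis//.
by rewrite mulrn_wge0// mulr_ge0// ltW// (ht j).1.
Qed.

End ExtremalBasis.

(** * Minimal generators of an ideal of a pointed monoid *)

Section MinimalGenerators.
Variables (R : realType) (d : nat) (T H : set 'rV[R]_d).
Hypotheses (T0 : T 0) (TD : forall x y, T x -> T y -> T (x + y)).
Hypothesis T_pointed : forall x y, T x -> T y -> x + y = 0 -> x = 0.

Lemma minimal_generator_in c : minimal_generator T H c -> H c.
Proof. by move=> [B [-> _] Bc]; exists c, 0; rewrite addr0. Qed.

(** If [z] were nonzero, [c] could be replaced by a generator lying below [y], so that [B] without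
    [c] would still generate [H]. *)
Lemma minimal_generator_irreducible c y z :
  minimal_generator T H c -> H y -> T z -> c = y + z -> z = 0.
Proof.
move=> [B [HB Bmin] Bc] Hy Tz cE; apply: contrapT => z0.
have Bc' : B `\ c = B.
  apply: Bmin; first by move=> ? [].
  have [y0 [t0 [By0 Tt0 yE]]] : ideal_gen T B y by rewrite -HB.
  (* Otherwise [z + t0 = 0], and pointedness forces [z = 0]. *)
  have y0c : y0 <> c.
    move=> y0c; apply/z0/(T_pointed Tz Tt0).
    apply: (addrI c); rewrite addr0 {2}cE yE y0c -addrA.
    by congr (_ + _); exact: addrC.
  rewrite HB; apply/seteqP; split=> _ [u [t [Bu Tt ->]]]; last first.
    by case: Bu => Bu _; exists u, t.
  have [uc|uc] := pselect (u = c); last by exists u, t.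
  exists y0, (t0 + z + t); split=> //; first by do 2?apply: TD.
  by rewrite uc cE yE !addrA.
by move: Bc; rewrite -Bc' => -[_]; apply.
Qed.

End MinimalGenerators.

(** * Cone, normalization, Apery elements and remainders in coordinates *)

Section Structure.
Variables (R : realType) (d : nat) (S : set 'rV[R]_d) (a : 'I_d -> 'rV[R]_d).
Hypotheses (S0 : S 0) (SD : forall x y, S x -> S y -> S (x + y)).
Hypotheses (S_nat : S `<=` @natvec R d) (aS : forall i, S (a i)).
Hypothesis a_free : free [tuple a i | i < d].
Hypothesis S_ge0 : forall x i, S x -> 0 <= acoord a x i.

Lemma semigroupMn x n : S x -> S (x *+ n).
Proof. by move=> Sx; elim: n => // n IH; rewrite mulrS; exact: SD. Qed.

Lemma semigroup_sumMn (n : 'I_d -> nat) : S (\sum_i a i *+ n i).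
Proof. by elim/big_ind: _ => // i _; exact/semigroupMn. Qed.

(** The difference has natural coordinates, so it is a sum of copies of the [a i]. *)
Lemma semigroup_add_lattice x y : S x -> lattice a (y - x) ->
  (forall i, 0 <= acoord a (y - x) i) -> S y.
Proof.
move=> Sx lat ge0.
have /choice[n hn] i : exists n : nat, acoord a (y - x) i = n%:R.
  by apply/natrP; rewrite natrEint lat ge0.
rewrite -(subrK x y) (acoordE a_free (y - x)).
apply: SD => //; rewrite (eq_bigr (fun i => a i *+ n i)) => [|i _].
  exact: semigroup_sumMn.
by rewrite hn scaler_nat.
Qed.

Lemma coneP x : cone S x <-> forall i, 0 <= acoord a x i.
Proof.
split=> [[n [s [l [sS l0 ->]]]] i|x0].
  rewrite acoord_bigsum sumr_ge0// => j _.
  by rewrite acoordZ mulr_ge0// S_ge0.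
by exists d, a, (acoord a x); split=> //; exact: acoordE.
Qed.

Lemma group_of_sub x : S x -> group_of S x.
Proof. by move=> Sx; exists x, 0; rewrite subr0. Qed.

Lemma group_ofD x y : group_of S x -> group_of S y -> group_of S (x + y).
Proof.
move=> [x1 [x2 [Sx1 Sx2 ->]]] [y1 [y2 [Sy1 Sy2 ->]]].
by exists (x1 + y1), (x2 + y2); split; [exact: SD|exact: SD|rewrite addrACA opprD].
Qed.

Lemma group_ofN x : group_of S x -> group_of S (- x).
Proof. by move=> [y [z [Sy Sz ->]]]; exists z, y; rewrite opprB. Qed.

Lemma group_ofB x y : group_of S x -> group_of S y -> group_of S (x - y).
Proof. by move=> Gx Gy; apply: group_ofD => //; exact: group_ofN. Qed.

Lemma normalization0 : normalization S 0.
Proof.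
split; first exact: group_of_sub.
by apply/coneP => i; rewrite acoord0.
Qed.

Lemma normalizationD x y :
  normalization S x -> normalization S y -> normalization S (x + y).
Proof.
move=> [Gx /coneP Cx] [Gy /coneP Cy]; split; first exact: group_ofD.
by apply/coneP => i; rewrite acoordD addr_ge0.
Qed.

Lemma normalization_pointed x y :
  normalization S x -> normalization S y -> x + y = 0 -> x = 0.
Proof.
move=> [_ /coneP Cx] [_ /coneP Cy] xy; apply: (acoord_inj a_free) => i.
have := congr1 (fun z => acoord a z i) xy; rewrite acoordD acoord0.
by have := Cx i; have := Cy i; lra.
Qed.

(** Subtract vectors [a i] as long as the result stays in [S]. Each subtraction lowers the
    coordinate sum by 1 and that sum is nonnegative on [S], so induction on a bound [N] for it
    terminates. *)
Lemma Apery_below x : S x ->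
  exists w, [/\ Apery S (range a) w, lattice a (x - w) &
                forall i, 0 <= acoord a (x - w) i].
Proof.
have : exists N : nat, \sum_i acoord a x i < N%:R.
  by eexists; exact: (truncnS_gt (\sum_i acoord a x i)).
move=> [N]; elim: N x => [|N IH] x xN Sx.
  by move: xN; rewrite ltNge sumr_ge0// => i _; exact: S_ge0.
have [Ax|nAx] := pselect (Apery S (range a) x).
  by exists x; split=> [//||i]; rewrite subrr ?acoord0//; exact: lattice0.
have [i Sxi] : exists i, S (x - a i).
  apply: contrapT => h; apply: nAx; split=> // _ [i _ <-] Si.
  by apply: h; exists i.
have [|w [Aw lw w0]] := IH (x - a i) _ Sxi.
  under eq_bigr do rewrite acoordB acoord_basis//.
  rewrite sumrB [X in _ - X](bigD1 i)//= eqxx [X in _ - (_ + X)]big1 => [|j /negPf ->//].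
  by rewrite addr0 ltrBlDr -natr1 in xN *.
exists w; split=> // [|j].
  by apply: lattice_sub_trans lw; rewrite opprB addrC subrK; exact: lattice_basis.
have := w0 j; rewrite !acoordB acoord_basis//.
have : 0 <= (j == i)%:R :> R by [].
lra.
Qed.

(** Modulo the lattice [y - z] equals [y + z *+ n], an element of [S], as soon as [z *+ n.+1] is a
    lattice vector. *)
Lemma group_of_Apery x : group_of S x ->
  exists2 w, Apery S (range a) w & lattice a (x - w).
Proof.
move=> [y [z [Sy Sz ->]]].
have [[//|n] _ ln] :=
  natvec_multiple_lattice a_free (fun i => S_nat (aS i)) (S_nat Sz).
have [w [Aw lw _]] := Apery_below (SD Sy (semigroupMn n Sz)).
exists w => //; apply: lattice_sub_trans lw.
by apply: lattice_subC; rewrite opprB addrC addrA subrK -mulrS.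
Qed.

Lemma remainderP x : S x -> is_remainder a x (remainder a x).
Proof.
move=> Sx; apply: (@xgetPex _ 0 [set r | is_remainder a x r]).
(* The remainder is obtained by subtracting the integer parts of the coordinates. *)
have [f hf] : exists f : 'I_d -> nat,
    forall i, (f i)%:R <= acoord a x i < (f i).+1%:R.
  by exists (fun i => Num.truncn (acoord a x i)) => i; rewrite truncn_itv// S_ge0.
pose r := x - \sum_i a i *+ f i.
have r01 i : 0 <= acoord a r i < 1.
  rewrite acoordB acoord_sumMn//; have := hf i; rewrite -natr1; lra.
exists r; split; [exact/parallelotopeP| |by exists f; rewrite addrC subrK].
(* Standard entries of [r] are integers, being differences of such, and nonnegative, since [r] is a
   nonnegative combination of the [a i]. *)
move=> j; apply/natrP; rewrite natrEint; apply/andP; split.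
  rewrite !mxE rpredB//; first by have [n ->] := S_nat Sx j; rewrite rpred_nat.
  by have [n ->] := S_nat (semigroup_sumMn f) j; rewrite rpred_nat.
rewrite (acoordE a_free r) summxE sumr_ge0// => i _; rewrite mxE mulr_ge0//.
  by have /andP[] := r01 i.
by have [n ->] := S_nat (aS i) j.
Qed.

Lemma remainder_spec x : S x ->
  [/\ forall i, 0 <= acoord a (remainder a x) i < 1,
      lattice a (x - remainder a x) & group_of S (remainder a x)].
Proof.
move=> Sx; have [/(parallelotopeP a_free) r01 _ [n xE]] := remainderP Sx.
have rE : x - remainder a x = \sum_i a i *+ n i by rewrite {1}xE addrK.
split=> //; first by rewrite rE; exact: lattice_sumMn.
rewrite -(subKr x (remainder a x)) rE.
by apply: group_ofB; apply: group_of_sub => //; exact: semigroup_sumMn.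
Qed.

Lemma remainder_unique x r : S x -> (forall i, 0 <= acoord a r i < 1) ->
  lattice a (x - r) -> remainder a x = r.
Proof.
move=> Sx r01 xr; have [q01 xq _] := remainder_spec Sx.
apply: (lattice_sub_cell a_free) => //.
by apply: lattice_sub_trans xr; exact: lattice_subC.
Qed.

End Structure.

(** * The conductor and its minimal generators *)

Lemma bigmax_int (R : realType) n (F : 'I_n -> R) : (forall j, F j \is a Num.int) ->
  \big[Num.max/0]_j F j \is a Num.int.
Proof. by move=> hF; elim/big_ind: _ => // x y; rewrite /Num.max; case: ifP. Qed.

Section ConductorGenerators.
Variables (R : realType) (d : nat) (S : set 'rV[R]_d) (a : 'I_d -> 'rV[R]_d).
Hypotheses (S0 : S 0) (SD : forall x y, S x -> S y -> S (x + y)).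
Hypotheses (S_nat : S `<=` @natvec R d) (aS : forall i, S (a i)).
Hypothesis a_free : free [tuple a i | i < d].
Hypothesis S_ge0 : forall x i, S x -> 0 <= acoord a x i.
Variables (k : nat) (b : 'I_k.+1 -> 'rV[R]_d).
Hypothesis b_rem : range b = remainder a @` Apery S (range a).

Lemma remainders_spec j :
  (forall i, 0 <= acoord a (b j) i < 1) /\ group_of S (b j).
Proof.
have [w [Sw _] <-] : (remainder a @` Apery S (range a)) (b j).
  by rewrite -b_rem; exists j.
by have [] := remainder_spec S0 SD S_nat aS a_free S_ge0 Sw.
Qed.

Lemma remainders_normalization j : normalization S (b j).
Proof.
have [b01 Gb] := remainders_spec j; split=> //.
by apply/(coneP aS a_free S_ge0) => i; case/andP: (b01 i).
Qed.

Lemma remainders_cover x : group_of S x -> exists j, lattice a (x - b j).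
Proof.
move=> /(group_of_Apery S0 SD S_nat aS a_free S_ge0)[w Aw xw].
have [j _ jE] : range b (remainder a w) by rewrite b_rem; exists w.
exists j; apply: lattice_sub_trans xw _; rewrite jE.
by have [] := remainder_spec S0 SD S_nat aS a_free S_ge0 Aw.1.
Qed.

(* The strict bound [-1 <] is enough because these coordinates are integers. *)
Lemma conductor_criterion (w : 'I_k.+1 -> 'rV[R]_d) y :
  (forall j, S (w j)) -> (forall j, lattice a (w j - b j)) ->
  group_of S y ->
  (forall p j i, lattice a (y + b p - b j) -> -1 < acoord a (y + b p - w j) i) ->
  conductor S y.
Proof.
move=> Sw wb Gy ybw.
have key z : normalization S z -> S (y + z).
  move=> [Gz /(coneP aS a_free S_ge0) z0].
  (* Replace [z] by the representative [b p] of its class: [z - b p] has integer coordinates greater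
     than -1, hence nonnegative, and [y + b p - w j] is controlled by [ybw]. *)
  have [p zp] := remainders_cover Gz.
  have [j yj] := remainders_cover (group_ofD SD Gy (remainders_spec p).2).
  have yw : lattice a (y + b p - w j).
    by apply: lattice_sub_trans yj _; exact: lattice_subC.
  have yzw : y + z - w j = y + b p - w j + (z - b p).
    by rewrite addrAC -[in RHS]addrA [in RHS]addrACA [b p + _]addrC addrNK addrAC.
  apply: (semigroup_add_lattice S0 SD aS a_free (Sw j)); rewrite yzw.
    exact: latticeD.
  move=> i; rewrite acoordD; apply: addr_ge0.
    have /intrP[m mE] := yw i; have := ybw p j i yj.
    by rewrite mE (_ : -1 = (-1)%:~R)// ltr_int ler0z; lia.
  have /intrP[m mE] := zp i; have := z0 i; have /andP[_] := (remainders_spec p).1 i.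
  move: mE; rewrite acoordB => mE b1 zi.
  have : (-1)%:~R < m%:~R :> R by rewrite -mE; lra.
  by rewrite mE ltr_int ler0z; lia.
by split=> //; rewrite -(addr0 y); apply/key/(normalization0 S0 aS a_free S_ge0).
Qed.

Hypothesis b_0 : b ord0 = 0.

(** Some [c + b p] lies in the class of [b j]. It belongs to [S] because [b p] is in the
    normalization, so it dominates an Apery element. *)
Lemma conductor_Apery c j : conductor S c ->
  exists w, [/\ Apery S (range a) w, remainder a w = b j &
    forall p i, lattice a (c + b p - b j) -> 0 <= acoord a (c + b p - w) i].
Proof.
move=> [Sc cS].
have [p hp] : exists p, lattice a (b j - c - b p).
  by apply: remainders_cover; apply: group_ofB (remainders_spec j).2 _ => //;
    exact: group_of_sub.
have cpj : lattice a (c + b p - b j).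
  by apply: lattice_subC; rewrite opprD addrA.
have [w [Aw cw cw0]] :=
  Apery_below a_free S_ge0 (cS _ (remainders_normalization p)).
exists w; split=> //.
  apply: (remainder_unique S0 SD S_nat aS a_free S_ge0 Aw.1).
    exact: (remainders_spec j).1.
  by apply: lattice_sub_trans cpj; exact: lattice_subC.
(* Only one [b p] satisfies the class condition, so the bound for that [p] covers every [q]. *)
move=> q i cqj; suff -> : b q = b p by exact: cw0.
apply: (lattice_sub_cell a_free); [exact: (remainders_spec q).1
  |exact: (remainders_spec p).1|].
have := lattice_sub_trans cqj (lattice_subC cpj).
by rewrite opprD addrACA subrr add0r.
Qed.

Lemma conductor_minimal_generator (hd : (0 < d)%N) c :
  minimal_generator (normalization S) (conductor S) c ->
  exists (w : 'I_k -> 'rV[R]_d) (l : 'I_d -> nat) (j : 'I_k.+1),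
    [/\ forall i : 'I_k, Apery S (range a) (w i) /\
                         remainder a (w i) = b (lift ord0 i),
        forall i, l i = 0%N \/ l i = 1%N,
        c = fvec a w - b j + \sum_i a i *+ l i &
        exists i, l i = 0%N].
Proof.
move=> c_min.
have cC : conductor S c.
  exact: (minimal_generator_in (normalization0 S0 aS a_free S_ge0) c_min).
have irr := minimal_generator_irreducible
  (fun x y => normalizationD SD aS a_free S_ge0 (x := x) (y := y))
  (fun x y => normalization_pointed aS a_free S_ge0 (x := x) (y := y)) c_min.
have Gc : group_of S c by case: cC => Sc _; exact: group_of_sub.
have Ga i : group_of S (a i) by exact: group_of_sub.
have b01 j i := (remainders_spec j).1 i.
(* [b j0] represents the class of [-c]. *)
have [j0 hj0] : exists j, lattice a (c + b j).
  have [j hj] := remainders_cover (group_ofN Gc).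
  by exists j; have := lattice_subC hj; rewrite opprK addrC.
have /choice[w hw] (i : 'I_k) := conductor_Apery (lift ord0 i) cC.
(* [0] is the only element of the Apery set with remainder [b ord0 = 0]. *)
pose W j := if unlift ord0 j is Some i then w i else 0.
have WE i : W (lift ord0 i) = w i by rewrite /W liftK.
have W0 : W ord0 = 0 by rewrite /W unlift_none.
have SW j : S (W j).
  by case: (unliftP ord0 j) => [i ->|->]; rewrite ?W0// WE; case: (hw i) => -[].
have WbE i : w i - remainder a (w i) = W (lift ord0 i) - b (lift ord0 i).
  by case: (hw i) => _ -> _; rewrite WE.
have Wb j : lattice a (W j - b j).
  case: (unliftP ord0 j) => [i ->|->]; last first.
    by rewrite W0 b_0 subrr; exact: lattice0.
  rewrite -WbE; case: (hw i) => -[Swi _] _ _.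
  by have [] := remainder_spec S0 SD S_nat aS a_free S_ge0 Swi.
have cW p j i : lattice a (c + b p - b j) -> 0 <= acoord a (c + b p - W j) i.
  case: (unliftP ord0 j) => [q ->|->]; first by rewrite WE; case: (hw q) => _ _; apply.
  move=> _; rewrite W0 subr0; apply: S_ge0; apply: cC.2.
  exact: remainders_normalization.
pose f i := \big[Num.max/0]_(q < k) acoord a (w q - remainder a (w q)) i.
have f0 i : 0 <= f i by apply: bigmax_ge_id.
have fint i : f i \is a Num.int.
  by apply: bigmax_int => q; rewrite WbE; exact: Wb.
have Wf j i : acoord a (W j - b j) i <= f i.
  case: (unliftP ord0 j) => [q ->|->]; last by rewrite W0 b_0 subrr acoord0.
  rewrite -WbE; exact: (le_bigmax 0 (fun q => acoord a (w q - remainder a (w q)) i)).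
pose m i := acoord a (c + b j0) i.
(* The starting value 0 of the maximum is covered by [c + b j0] being in [S]. For the other terms,
   [W j] is dominated by [c + b p], and [b p] has coordinates below 1, so the integer [v] is less
   than [u + 1]. *)
have mf i : f i <= m i.
  apply/bigmax_leP; split=> [|q _].
    by apply: S_ge0; apply: cC.2; exact: remainders_normalization.
  set j := lift ord0 q; rewrite WbE -/j.
  have [p hp] : exists p, lattice a (c + b p - b j).
    have [p hp] := remainders_cover (group_ofB SD (remainders_spec j).2 Gc).
    by exists p; apply: lattice_subC; rewrite opprD addrA.
  have := cW p j i hp; have := b01 p i; have := b01 j0 i; have := b01 j i.
  have /intrP[u uE] := hj0 i; have /intrP[v vE] := Wb j i.
  move: uE vE; rewrite /m !(acoordD, acoordN) => uE vE bj bj0 bp cp.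
  have : v%:~R < (u + 1)%:~R :> R by rewrite intrD -uE -vE; lra.
  by rewrite uE vE ltr_int ler_int; lia.
have /choice[l hl] i : exists n : nat, m i - f i = n%:R.
  by apply/natrP; rewrite natrEint rpredB ?subr_ge0 ?mf// hj0.
exists w, l, j0; split.
- by move=> i; have [] := hw i.
(* If [l i >= 2], coordinate [i] of [c - a i + b p - W j] is at least [l i - 1 + b p - b j0 - b j],
   which exceeds -1 because the two subtracted remainders are each below 1. The other coordinates
   are those of [c + b p - W j]. *)
- move=> i; suff : (l i < 2)%N by case: (l i) => [|[|?]]; auto.
  rewrite ltnNge; apply/negP => l2.
  have [] : a i <> 0.
    move=> ai0; have := acoord_basis a_free i i.
    by rewrite ai0 acoord0 eqxx => /eqP; rewrite eq_sym oner_eq0.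
  apply: (irr (c - a i) (a i)); last by rewrite subrK.
    apply: (conductor_criterion SW Wb); first exact: group_ofB.
    move=> p j i' hpj.
    have {}hpj : lattice a (c + b p - b j).
      have := latticeD hpj (lattice_basis a_free i).
      by rewrite addrAC [_ + b p + a i]addrAC subrK.
    have := cW p j i' hpj; rewrite !(acoordD, acoordN) acoord_basis//.
    have [->|_] := eqVneq i' i; last by rewrite subr0; lra.
    rewrite mulr1n.
    have lR : 2%:R <= (l i)%:R :> R by rewrite ler_nat.
    have := Wf j i; have := b01 p i; have := b01 j0 i; have := b01 j i.
    have := hl i; rewrite /m !(acoordD, acoordN); lra.
  split=> //; apply/(coneP aS a_free S_ge0) => i'.
  exact: S_ge0.
- apply: (acoord_inj a_free) => i.
  rewrite acoordD acoordB acoord_sumMn// -hl /fvec acoord_sum// -/(f i) /m acoordD.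
  lra.
- apply: contrapT => l1.
  have {}l1 i : 1 <= (l i)%:R :> R.
    by rewrite (ler_nat R 1) lt0n; apply/negP => /eqP li; apply: l1; exists i.
  (* The exponent 1 gives [s] the form expected by [semigroup_sumMn] and [acoord_sumMn]. *)
  pose s := \sum_i a i *+ 1.
  have Gs : group_of S s by apply: group_of_sub => //; exact: semigroup_sumMn.
  have sE i : acoord a s i = 1 by rewrite acoord_sumMn.
  (* Subtracting [s - b j0] from [c] leaves [c + b j0 - s], with coordinates [f + l - 1 >= f]. After
     adding [b p] it falls short of [W j] by at most [b j - b p], which is less than 1. *)
  have : s - b j0 = 0.
    apply: (irr (c - (s - b j0)) (s - b j0)); last by rewrite subrK.
      apply: (conductor_criterion SW Wb).
        do 2?apply: group_ofB => //; exact: (remainders_spec j0).2.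
      move=> p j i _.
      have := Wf j i; have := b01 p i; have := b01 j i; have := l1 i.
      have := hl i; have := sE i; rewrite /m !(acoordD, acoordN); lra.
    split; first by apply: group_ofB => //; exact: (remainders_spec j0).2.
    apply/(coneP aS a_free S_ge0) => i; rewrite acoordB sE.
    by have := b01 j0 i; lra.
  (* All coordinates of [s - b j0] are positive, and [hd] supplies one to contradict the
     equation. *)
  move=> /(congr1 (fun x => acoord a x (Ordinal hd))).
  by rewrite acoordB sE acoord0; have := b01 j0 (Ordinal hd); lra.
Qed.

End ConductorGenerators.

(** * Passage from the simplicial semigroup to the coordinate hypotheses *)

Theorem theorem4p9 (R : realType) (d : nat) (hd : (0 < d)%N)
    (S : set 'rV[R]_d) (S_affine : affine_semigroup S)
    (S_simplicial : simplicial S)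
    (a : 'I_d -> 'rV[R]_d) (a_inj : injective a)
    (a_extremal : range a = extremal_rays S)
    (k : nat) (b : 'I_k.+1 -> 'rV[R]_d) (b_inj : injective b)
    (b_0 : b ord0 = 0)
    (b_rem : range b = remainder a @` Apery S (range a))
    (C : 'I_k.+1 -> set 'rV[R]_d)
    (C_def : forall j, C j = [set w | Apery S (range a) w /\ remainder a w = b j])
    (c : 'rV[R]_d)
    (c_min : minimal_generator (normalization S) (conductor S) c) :
  exists (w : 'I_k -> 'rV[R]_d) (l : 'I_d -> nat) (j : 'I_k.+1),
    [/\ forall i : 'I_k, C (lift ord0 i) (w i),
        forall i, l i = 0%N \/ l i = 1%N,
        c = fvec a w - b j + \sum_i a i *+ l i &
        exists i, l i = 0%N].
Proof.
have [S_nat [G _ SG]] := S_affine.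
have [a_free S_ge0] := extremal_rays_basis S_affine S_simplicial a_inj a_extremal.
have S0 : S 0 by rewrite SG; exact: monoid_gen0.
have SD x y : S x -> S y -> S (x + y) by rewrite SG; exact: monoid_genD.
have aS i : S (a i).
  have [] // : extremal_rays S (a i) by rewrite -a_extremal; exists i.
have [w [l [j [wC l01 cE l0]]]] := conductor_minimal_generator
  S0 SD S_nat aS a_free S_ge0 b_rem b_0 hd c_min.
by exists w, l, j; split=> // i; rewrite C_def.
Qed.
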